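(* Let $n \geq 2$ be an integer and let $p(z) = z^n + a_{n-1}z^{n-1} + \cdots + a_1 z + a_0$ be a monic polynomial of degree $n$ with complex coefficients. Let $z_1, \ldots, z_n \in \mathbb{C}$ be the zeros of $p$, listed with multiplicity (in any order), so that $p(z) = \prod_{j=1}^n (z - z_j)$. Let $$c = \frac{z_1 + \cdots + z_{n-1}}{n-1},$$ and let $C \subset \mathbb{C}$ be a disc (open or closed) centered at $c$ which contains $z_1, \ldots, z_{n-1}$. Then $C$ contains at least $$\left[ \frac{n-1}{2} \right]$$ zeros of the derivative $p'(z)$, counted with multiplicity.
   Context: $[x]$ denotes the integer part (floor) of the real number $x$. Zeros of $p$ and of $p'$ are counted with multiplicity. A disc may be either open or closed. *)

(* Defs.v *)
From mathcomp Require Export all_boot all_order all_algebra.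
From mathcomp Require Export reals complex.

Set Implicit Arguments.
Unset Strict Implicit.
Unset Printing Implicit Defensive.

Import Order.TTheory GRing.Theory Num.Theory.
Local Open Scope ring_scope.
Local Open Scope complex_scope.

(* The zeros of q, repeated according to multiplicity (see count_mem_zeros);
   only meaningful for q != 0. *)
Definition zeros (F : closedFieldType) (q : {poly F}) : seq F :=
  sval (closed_field_poly_normal q).

Lemma zerosP (F : closedFieldType) (q : {poly F}) :
  q = lead_coef q *: \prod_(w <- zeros q) ('X - w%:P).
Proof. exact: svalP (closed_field_poly_normal q). Qed.

Lemma count_mem_zeros (F : closedFieldType) (q : {poly F}) (w : F) :
  q != 0 -> count_mem w (zeros q) = mup w q.
Proof.
move=> q0; have l0 : lead_coef q != 0 by rewrite lead_coef_eq0.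
rewrite [in RHS](zerosP q) -mul_polyC mupMr ?rootC //.
elim: (zeros q) => [|y s IH] /=.
  by rewrite big_nil mupNroot // rootE hornerC oner_eq0.
rewrite big_cons mupM ?polyXsubC_eq0 ?monic_neq0 ?monic_prod_XsubC //.
by rewrite -IH -['X - y%:P]expr1 mup_XsubCX; case: eqP.
Qed.

Definition num_zeros_in (F : closedFieldType) (q : {poly F}) (D : {pred F}) : nat :=
  count (mem D) (zeros q).

Definition open_disc (R : realType) (c : R[i]) (r : R) : {pred R[i]} :=
  [pred w : R[i] | `|w - c| < r%:C].

Definition closed_disc (R : realType) (c : R[i]) (r : R) : {pred R[i]} :=
  [pred w : R[i] | `|w - c| <= r%:C].

Definition disc_centered_at (R : realType) (c : R[i]) (D : {pred R[i]}) : Prop :=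
  exists2 r : R, 0 < r & D =i open_disc c r \/ D =i closed_disc c r.

(* Main.v *)
Require Import Defs.
From mathcomp Require Import ring zify.

(** Write [m = n.-1] and [zeta] for the last zero [z_n]; distances are taken
    from [c], and [r] is the radius of a closed disc about [c] that lies in [C]
    and contains the first [m] zeros ([closed_subdisc]).

    By Laguerre's theorem ([norm_sum_inv_le]), at a point [w] outside that disc
    the first [m] zeros contribute to the logarithmic derivative of [p] as much
    as one zero [alpha] of multiplicity [m] somewhere in the disc. If [w] is
    critical, then [m / (w - alpha) + 1 / (w - zeta) = 0], that is,
    [n * w = m * zeta + alpha]. So every critical point outside the disc lies
    within [r / n] of the one point [c + s], where [s = m / n * (zeta - c)]
    ([critical_point_outside]).

    The zeros of [p'] have the same mean as those of [p], and [c] is the mean of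
    the first [m] zeros, so the critical points, measured from [c], add up to
    the same [s] ([critical_point_seq]). If [k] of them are outside the disc,
    then they contribute about [k * s] to this sum, and the [m - k] others, of
    size at most [r], must cancel about [k.-1 * s]. As soon as [k > 0], the
    point [s] has norm greater than [r - r / n], and so [k] cannot be much
    larger than [m - k]: the precise estimates give [k.*2 <= m.+1]
    ([half_in_disc_of_sum]), which leaves at least [m./2] critical points in
    the disc. *)

Set Implicit Arguments.
Unset Strict Implicit.
Unset Printing Implicit Defensive.

Import Order.TTheory GRing.Theory Num.Theory.
Local Open Scope ring_scope.

(** The inverse of [a - x] is [u] exactly when [x * u = a * u - 1], so the left
    side says that [u] is inverse to [a - x] for some [x] in the closed disc of
    radius [r] about 0. Inversion turns discs into discs; what matters is that
    the right side describes a disc in [u], hence a convex condition. *)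
Lemma norm_inversion_disc (F : numClosedFieldType) (a u r : F) :
  0 <= r -> r < `|a| ->
  (`|a * u - 1| <= r * `|u|) = (`|(`|a| ^+ 2 - r ^+ 2) * u - a^*| <= r).
Proof.
move=> r0 ra; have d0 : 0 < `|a| ^+ 2 - r ^+ 2.
  by rewrite subr_gt0 ltr_pXn2r // nnegrE.
have rE : r^* = r by apply/CrealP/ger0_real.
rewrite -[LHS]ler_sqr ?nnegrE ?mulr_ge0 // -[RHS]ler_sqr ?nnegrE //.
(* The two differences of squares agree up to the positive factor
   [`|a| ^+ 2 - r ^+ 2], which is therefore put on the left one. *)
rewrite -[LHS]subr_ge0 -[RHS]subr_ge0 -[LHS](pmulr_rge0 _ d0); congr (0 <= _).
rewrite exprMn !normCK !(rmorphB, rmorphM, rmorph1, rmorphXn) /= !conjCK rE.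
ring.
Qed.

(** A form of Laguerre's theorem. When the sum of inverses is not zero, write it
    as [(size s)%:R / (w - alpha)]; then the conclusion says that
    [`|alpha - c| <= r]: seen from a point outside a disc, the zeros of a
    polynomial lying in that disc act like a single multiple zero in the disc.
    It holds because the mean of the inverses stays in the convex image of the
    disc under inversion. *)
Lemma norm_sum_inv_le (F : numClosedFieldType) (s : seq F) (c r w : F) :
  0 <= r -> {in s, forall z, `|z - c| <= r} -> r < `|w - c| ->
  `|(w - c) * (\sum_(z <- s) (w - z)^-1) - (size s)%:R|
    <= r * `|\sum_(z <- s) (w - z)^-1|.
Proof.
move=> r0 sr rw; have [->|s0] := eqVneq s [::].
  by rewrite big_nil mulr0 subr0 !normr0 mulr0.
have m0 : 0 < (size s)%:R :> F by rewrite ltr0n lt0n size_eq0.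
set S := \sum_(z <- s) _; set a := w - c in rw *; set d := `|a| ^+ 2 - r ^+ 2.
(* [u] is the mean of the inverses. *)
have [u uE] : {u | S = (size s)%:R * u}.
  by exists (S / (size s)%:R); rewrite mulrC divfK ?gt_eqF.
have -> : a * S - (size s)%:R = (size s)%:R * (a * u - 1) by rewrite uE; ring.
rewrite uE !normrM normr_nat mulrCA ler_pM2l // norm_inversion_disc //.
rewrite -(ler_pM2l m0) -[X in X * `|_| <= _]normr_nat -normrM.
have -> : (size s)%:R * (d * u - a^*) = \sum_(z <- s) (d * (w - z)^-1 - a^*).
  rewrite sumrB -mulr_sumr -/S uE big_const_seq count_predT iter_addr_0.
  by rewrite -mulr_natl; ring.
apply: le_trans (ler_norm_sum _ _ _) _.
have -> : (size s)%:R * r = \sum_(z <- s) r.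
  by rewrite big_const_seq count_predT iter_addr_0 mulr_natl.
rewrite big_seq [leRHS]big_seq; apply: ler_sum => z /sr zr.
rewrite -norm_inversion_disc //.
have wz : w - z != 0.
  rewrite subr_eq0; apply: contraTneq rw => wz.
  by rewrite /a wz -real_leNgt ?ger0_real.
have -> : a * (w - z)^-1 - 1 = (z - c) * (w - z)^-1 by rewrite /a; field.
by rewrite normrM ler_wpM2r.
Qed.

Lemma horner_deriv_prod_XsubC (F : fieldType) (s : seq F) (w : F) :
  w \notin s ->
  (\prod_(z <- s) ('X - z%:P))^`().[w] =
    (\prod_(z <- s) ('X - z%:P)).[w] * \sum_(z <- s) (w - z)^-1.
Proof.
elim: s => [|z s IH]; first by rewrite !big_nil derivC horner0 mulr0.
rewrite inE negb_or => /andP[wz /IH {}IH]; rewrite !big_cons derivM derivXsubC.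
rewrite !hornerE IH; have wz0 : w - z != 0 by rewrite subr_eq0.
by field.
Qed.

(** At such a [w] the logarithmic derivative vanishes:
    [\sum_(z <- s) (w - z)^-1 = - (w - zeta)^-1]. With [alpha] the equivalent
    multiple zero given by [norm_sum_inv_le] and [m = size s], this reads
    [m.+1 * w = m * zeta + alpha], where [`|alpha - c| <= r]. *)
Lemma critical_point_outside (F : numClosedFieldType) (s : seq F)
    (c r zeta w : F) :
  0 <= r -> {in s, forall z, `|z - c| <= r} ->
  root (\prod_(z <- s) ('X - z%:P) * ('X - zeta%:P))^`() w ->
  r < `|w - c| ->
  `|(size s).+1%:R * (w - c) - (size s)%:R * (zeta - c)| <= r.
Proof.
move=> r0 sr rw0 rw; have ws : w \notin s.
  by apply: contraTN rw => /sr; rewrite -real_leNgt ?ger0_real.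
have := norm_sum_inv_le r0 sr rw; move: rw0.
rewrite rootE derivM derivXsubC !hornerE horner_deriv_prod_XsubC //.
set S := \sum_(z <- s) _; set q := (_).[w].
have q0 : q != 0 by rewrite -[_ == 0]/(root _ w) root_prod_XsubC.
have -> : q * S * (w - zeta) + q = q * (S * (w - zeta) + 1) by ring.
rewrite mulf_eq0 (negPf q0) /= => /eqP SE.
have S0 : S != 0.
  by apply/eqP => S0; move: SE; rewrite S0 mul0r add0r; apply/eqP/oner_neq0.
have -> : (w - c) * S - (size s)%:R =
    ((size s).+1%:R * (w - c) - (size s)%:R * (zeta - c)) * S.
  by rewrite -[LHS]addr0 -(mulr0 (size s)%:R) -SE -natr1; ring.
by rewrite normrM ler_pM2r ?normr_gt0.
Qed.

Lemma size_zeros (F : closedFieldType) (q : {poly F}) :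
  q != 0 -> size q = (size (zeros q)).+1.
Proof.
move=> q0; rewrite {1}(zerosP q) size_scale ?lead_coef_eq0 //.
by rewrite size_prod_XsubC.
Qed.

Lemma sum_zeros (F : closedFieldType) (q : {poly F}) :
  (1 < size q)%N ->
  lead_coef q * \sum_(w <- zeros q) w = - q`_(size q).-2.
Proof.
move=> q1; have q0 : q != 0 by rewrite -size_poly_gt0 ltnW.
have z0 : size (zeros q) != 0 by move: q1; rewrite size_zeros // ltnS lt0n.
rewrite [in RHS]size_zeros //= [X in polyseq X]zerosP coefZ.
by rewrite coefPn_prod_XsubC // mulrN opprK.
Qed.

(** A polynomial and its derivative have zeros with the same mean: compare the
    two leading coefficients of both. *)
Lemma critical_point_seq (F : numClosedFieldType) (t : seq F) (m : nat) :
  size t = m.+1 -> let p := \prod_(z <- t) ('X - z%:P) in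
  [/\ p^`() != 0, size (zeros p^`()) = m &
      m.+1%:R * \sum_(w <- zeros p^`()) w = m%:R * \sum_(z <- t) z].
Proof.
move=> tm p.
have sp : size p = m.+2 by rewrite size_prod_XsubC tm.
have p'm : p^`()`_m = m.+1%:R.
  rewrite coef_deriv -[m.+1]/(m.+2.-1) -sp -/(lead_coef p).
  by rewrite (monicP (monic_prod_XsubC _ _ _)).
have sp' : size p^`() = m.+1.
  apply/eqP; rewrite eqn_leq -ltnS -sp.
  rewrite lt_size_deriv ?monic_neq0 ?monic_prod_XsubC //= ltnNge.
  apply/negP => /leq_sizeP/(_ _ (leqnn _))/eqP.
  by rewrite p'm pnatr_eq0.
have p'0 : p^`() != 0 by rewrite -size_poly_gt0 sp'.
have sz : size (zeros p^`()) = m by apply: succn_inj; rewrite -size_zeros.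
split=> //; case: m => [|m] in tm sp p'm sp' sz *.
  by rewrite (size0nil sz) big_nil mul0r mulr0.
rewrite -p'm -[m.+1]/(m.+2.-1) -sp' -/(lead_coef _) sum_zeros ?sp' //=.
rewrite coef_deriv -[m.+1]/(m.+2.-1) -tm coefPn_prod_XsubC ?tm //=.
by rewrite mulNrn opprK mulr_natl.
Qed.

(** The heart of the counting argument. Here [x] stands for the [m] centred
    critical points and [s] for their sum. Let [k] of them be far, that is, of
    norm greater than [r]; each of these lies within [r / m.+1] of [s].
    Adding up all of [x], the far points alone produce about [k * s], whereas
    the total is only [s]: the other [m - k] points, of norm at most [r], must
    make up for [k.-1] copies of [s], so
      [k.-1 * |s| <= k * r / m.+1 + (m - k) * r].
    One far point already forces [|s| > r - r / m.+1], and the two inequalities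
    together are incompatible with [m.+1 < k.*2]. *)
Lemma half_in_disc_of_sum (F : numClosedFieldType) (x : seq F) (r : F) :
  0 <= r ->
  {in x, forall w, r < `|w| ->
     (size x).+1%:R * `|w - \sum_(v <- x) v| <= r} ->
  ((size x)./2 <= count (fun w => (`|w| <= r)%R) x)%N.
Proof.
move=> r0; set m := size x; set s := \sum_(v <- x) v => far.
have out (w : F) : ~~ (`|w| <= r) = (r < `|w|) by rewrite real_ltNge ?ger0_real.
have := count_predC (fun w => `|w| <= r) x; rewrite -/m.
set k := count (predC _) x => mk.
suff: (k.*2 <= m.+1)%N by lia.
rewrite leqNgt; apply/negP => km.
have n0 : 0 < m.+1%:R :> F by rewrite ltr0n.
(* A far point exists since [0 < k]; [s] is close to it, hence not small. *)
have sk : m%:R * r < m.+1%:R * `|s|.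
  have : has (predC (fun w => `|w| <= r)) x by rewrite has_count -/k; lia.
  case/hasP=> w wx /=; rewrite out => rw.
  have tri : m.+1%:R * `|w| <= r + m.+1%:R * `|s|.
    rewrite (le_trans _ (lerD (far w wx rw) (lexx _))) // -mulrDr ler_pM2l //.
    by rewrite -{1}[w](subrK s) ler_normD.
  rewrite -(ltrD2l r); apply: lt_le_trans tri.
  by rewrite addrC -[X in _ + X]mul1r -mulrDl natr1 ltr_pM2l.
(* [k.-1 * s] is minus the sum of [w - s] over the far points and of [w] over
   the others. *)
have bound : k.-1%:R * (m.+1%:R * `|s|) <= (k + m.+1 * (m - k))%:R * r.
  have k0 : (0 < k)%N by lia.
  have -> : k.-1%:R * (m.+1%:R * `|s|) =
      `|\sum_(w <- x | ~~ (`|w| <= r)) m.+1%:R * (w - s)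
        + \sum_(w <- x | `|w| <= r) m.+1%:R * w|.
    rewrite -!mulr_sumr -mulrDr normrM normr_nat mulrCA; congr (_ * _).
    rewrite sumrB big_const_seq -/k iter_addr_0 addrAC [X in X - _]addrC.
    rewrite -[X in X - _](bigID (fun w => `|w| <= r) xpredT id) -/s.
    by rewrite -{2}(prednK k0) mulrS opprD addNKr normrN normrMn mulr_natl.
  apply: le_trans (ler_normD _ _) _; rewrite natrD mulrDl lerD //.
    apply: le_trans (ler_norm_sum _ _ _) _.
    apply: (@le_trans _ _ (\sum_(w <- x | ~~ (`|w| <= r)) r)).
      rewrite big_seq_cond [leRHS]big_seq_cond.
      apply: ler_sum => w /andP[wx]; rewrite out => rw.
      by rewrite normrM normr_nat far.
    by rewrite big_const_seq -/k iter_addr_0 mulr_natl.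
  apply: le_trans (ler_norm_sum _ _ _) _.
  apply: (@le_trans _ _ (\sum_(w <- x | `|w| <= r) m.+1%:R * r)).
    by apply: ler_sum => w wr; rewrite normrM normr_nat ler_wpM2l.
  rewrite big_const_seq iter_addr_0 -mulrnAl -mulrnA.
  by rewrite -mk addnK.
have k1 : (0 < k.-1)%N by lia.
(* Cancelling [r] leaves [k.-1 * m < k + m.+1 * (m - k)] in [nat]. *)
have := lt_le_trans (_ : k.-1%:R * (m%:R * r) < _) bound.
rewrite ltr_pM2l ?ltr0n // => /(_ sk); rewrite mulrA -natrM.
have [->|rn0] := eqVneq r 0; first by rewrite !mulr0 ltxx.
rewrite ltr_pM2r ?lt0r ?rn0 // ltr_nat.
have : (k <= m)%N by lia.
nia.
Qed.

(** Since [c] is the mean of [s], the centred critical points sum to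
    [m / m.+1 * (zeta - c)], which is also the point around which
    [critical_point_outside] gathers those outside the disc. This coincidence
    is what makes [half_in_disc_of_sum] applicable. *)
Lemma critical_points_in_disc (F : numClosedFieldType) (s : seq F)
    (c r zeta : F) :
  0 <= r -> \sum_(z <- s) z = (size s)%:R * c ->
  {in s, forall z, `|z - c| <= r} ->
  ((size s)./2 <=
    count (fun w => (`|w - c| <= r)%R)
      (zeros (\prod_(z <- s) ('X - z%:P) * ('X - zeta%:P))^`())%R)%N.
Proof.
move=> r0 sc sr; set m := size s in sc *; set p := _ * _.
have pE : p = \prod_(z <- rcons s zeta) ('X - z%:P) by rewrite big_rcons.
have [] := critical_point_seq (size_rcons s zeta); rewrite -pE.
set ws := zeros _ => p'0 sw sumw.
have n0 : m.+1%:R != 0 :> F by rewrite pnatr_eq0.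
pose x := [seq w - c | w <- ws].
have sumx : m.+1%:R * \sum_(v <- x) v = m%:R * (zeta - c).
  rewrite big_map sumrB mulrBr sumw big_rcons /= sc big_const_seq count_predT.
  by rewrite iter_addr_0 sw -mulr_natl -natr1; ring.
have <- : count (fun w => `|w| <= r) x = count (fun w => `|w - c| <= r) ws.
  by rewrite count_map.
have -> : m = size x by rewrite size_map sw.
apply: half_in_disc_of_sum => // _ /mapP[w ww ->] rw.
rewrite -[X in X * _]normr_nat -normrM size_map sw mulrBr sumx.
apply: critical_point_outside => //.
by rewrite -/p [X in root X _]zerosP rootZ ?lead_coef_eq0 // root_prod_XsubC.
Qed.

(** For an open disc, shrink the radius to the largest distance from [c] to one
    of the finitely many points, possibly 0; open and closed discs can then be
    treated alike. *)
Lemma closed_subdisc (R : realType) (I : finType) (z : I -> R[i]) (c : R[i])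
    (P : {pred I}) (C : {pred R[i]}) :
  disc_centered_at c C -> {in P, forall j, z j \in C} ->
  exists r : R[i], [/\ 0 <= r, {in P, forall j, `|z j - c| <= r} &
    forall w, `|w - c| <= r -> w \in C].
Proof.
case=> r r0 [CE|CE] zC; last first.
  exists (r%:C)%C; split=> [|j /zC|w wr]; rewrite ?CE //.
  by rewrite ler0c ltW.
have normE (x : R[i]) : `|x| = (complex.Re `|x|)%:C%C by rewrite normc_def.
pose rho := \big[Order.max/0]_(j in P) complex.Re `|z j - c|.
have rho_lt : rho < r.
  by apply: bigmax_lt => // j /zC; rewrite CE inE normE ltcR.
exists (rho%:C)%C; split=> [|j jP|w wr]; first by rewrite ler0c bigmax_ge_id.
  by rewrite normE lecR; apply: le_bigmax_cond.
by rewrite CE inE; apply: le_lt_trans wr _; rewrite ltcR.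
Qed.

Local Open Scope complex_scope.

Theorem theorem1 (R : realType) (n : nat) (p : {poly R[i]}) (z : 'I_n -> R[i])
    (c : R[i]) (C : {pred R[i]}) :
  (2 <= n)%N ->
  p \is monic ->
  size p = n.+1 ->
  p = \prod_(j < n) ('X - (z j)%:P) ->
  c = (\sum_(j < n | (j < n.-1)%N) z j) / (n.-1)%:R ->
  disc_centered_at c C ->
  (forall j : 'I_n, (j < n.-1)%N -> z j \in C) ->
  (n.-1 %/ 2 <= num_zeros_in p^`() C)%N.
Proof.
case: n z => // m z; rewrite ltnS => m0 _ _ pE cE discC zC.
have [r [r0 zr rC]] := closed_subdisc discC zC.
pose s := [seq z (widen_ord (leqnSn m) j) | j <- enum 'I_m].
have sm : size s = m by rewrite size_map size_enum_ord.
have {}pE : p = \prod_(w <- s) ('X - w%:P) * ('X - (z ord_max)%:P).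
  by rewrite pE big_ord_recr big_map big_enum.
rewrite divn2 -sm pE /=; apply: leq_trans (sub_count rC _).
apply: critical_points_in_disc => //.
  rewrite cE sm mulrC divfK ?pnatr_eq0 -?lt0n // big_map big_enum /=.
  rewrite [in RHS]big_mkcond big_ord_recr /= ltnn addr0.
  by apply: eq_bigr => j _; rewrite ltn_ord.
by move=> _ /mapP[j _ ->]; apply: (zr (widen_ord _ j) (ltn_ord j)).
Qed.
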